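(* Let $G=N\rtimes H$ be a finite Frobenius group with kernel $N$ and complement $H$, where $|N|=q\ge 3$ and $|H|=q-1$, and let $\pi:G\to H$, $\pi(nh)=h$ for $n\in N$, $h\in H$, be the quotient map. Then every inverse-closed subset $S\subset G\setminus\{1\}$ that is a union of conjugacy classes of $G$ is uniquely of the form \[ S_{\varepsilon,E}=\varepsilon(N\setminus\{1\})\sqcup\pi^{-1}(E), \] where $\varepsilon\in\{0,1\}$ and $E\subset H\setminus\{1\}$ is an inverse-closed union of conjugacy classes of $H$. Moreover, $S_{\varepsilon,E}$ generates $G$ if and only if $E$ generates $H$.
   Context: A finite group $G$ is a Frobenius group with kernel $N$ and complement $H$ if $G=N\rtimes H$ is a semidirect product in which $C_N(h)=1$ for every $1\ne h\in H$. The notation $\varepsilon(N\setminus\{1\})$ means the empty set if $\varepsilon=0$ and $N\setminus\{1\}$ if $\varepsilon=1$. *)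

(* Defs.v *)
From mathcomp Require Import all_boot all_fingroup all_solvable.

Set Implicit Arguments.
Unset Strict Implicit.
Unset Printing Implicit Defensive.

Local Open Scope group_scope.

Section Definitions.

Variable gT : finGroupType.
Implicit Types (A B E S : {set gT}) (G H N : {group gT}).

(* [semiregular N H] is 'C_N[h] = 1 for all h in H^#.  Nothing forces N and H
   to be nontrivial; when they are, this is [Frobenius G = N ><| H], see
   [frobenius_semidirectP] below. *)
Definition frobenius_semidirect G N H : Prop :=
  N ><| H = G /\ semiregular N H.

Definition inverse_closed S : Prop := {in S, forall x, x^-1 \in S}.

Definition union_of_classes G S : Prop :=
  exists2 C : {set {set gT}}, C \subset classes G & S = cover C.

(* [remgr N H] is the projection n * h |-> h of N ><| H onto H
   (see [remgrMid]); it is meaningful only on G. *)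
Definition proj_preim G N H E : {set gT} := [set g in G | remgr N H g \in E].

Definition scaled_kernel (eps : bool) N : {set gT} :=
  if eps then N^# else set0.

Definition S_set G N H (eps : bool) E : {set gT} :=
  scaled_kernel eps N :|: proj_preim G N H E.

Definition admissible H E : Prop :=
  [/\ E \subset H^#, inverse_closed E & union_of_classes H E].

Lemma frobenius_semidirectP G N H :
  N :!=: 1 -> H :!=: 1 ->
  frobenius_semidirect G N H <-> [Frobenius G = N ><| H].
Proof.
move=> ntN ntH; split=> [[defG regNH] | frobG].
  by apply/(Frobenius_semiregularP defG ntN ntH).
have [defG _ _ _ _] := Frobenius_context frobG.
by split=> //; apply/(Frobenius_semiregularP defG ntN ntH).
Qed.

End Definitions.

(* Main.v *)
(** Conjugation by [N] moves [h <> 1] in [H] inside the coset [N h], freely since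
    [C_N(h) = 1], so its orbit is all of [N h]; dually, [x <> 1] in [N] has
    trivial centraliser in [H], so its [H]-orbit has [q - 1] elements and is
    [N \ {1}].  Hence a union of classes is a union of [N]-cosets outside [N],
    and contains all or nothing of [N \ {1}]. *)

Require Import Defs.
From mathcomp Require Import all_boot all_fingroup all_solvable.

Local Open Scope group_scope.

(** Trades the covering family for a normaliser condition, which passes easily to intersections and
    to membership of conjugates. Conversely, the classes of the elements of [S] form a cover. *)
Lemma union_of_classesP (gT : finGroupType) (G : {group gT}) (S : {set gT}) :
  union_of_classes G S <-> S \subset G /\ G \subset 'N(S).
Proof.
split=> [[C sCG ->] | [sSG nSG]].
  split.
    by apply/bigcupsP=> A /(subsetP sCG)/imsetP[x Gx ->]; rewrite class_subG.
  apply: norms_bigcup; apply/bigcapsP=> A /(subsetP sCG)/imsetP[x Gx ->].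
  exact: class_norm.
exists [set x ^: G | x in S]; first exact: imsetS.
apply/setP=> y; apply/idP/bigcupP=> [Sy | [_ /imsetP[x Sx ->]]].
  by exists (y ^: G); [apply: imset_f | apply: class_refl].
by apply/subsetP; rewrite class_sub_norm.
Qed.

Section SemiregularSemidirect.

Context {gT : finGroupType} {G N H : {group gT}}.
Hypotheses (defG : N ><| H = G) (regNH : semiregular N H).

Lemma coset_class h : h \in H^# -> h ^: N = N :* h.
Proof.
move=> Hh; have [_ Hh'] := setD1P Hh.
have [_ _ _ nNH _] := sdprod_context defG.
(* Trivial centraliser: the class has [#|N|] elements, as many as the coset, so one inclusion
   suffices. *)
apply/eqP; rewrite eqEcard card_rcoset -index_cent1 regNH // indexg1 leqnn andbT.
apply/subsetP=> _ /imsetP[n Nn ->].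
rewrite mem_rcoset conjgE -!mulgA groupMl ?groupV //.
by rewrite -[h in h * _]invgK -conjgE memJ_norm ?groupV // (subsetP nNH).
Qed.

Lemma kernel_class x : #|H| = #|N|.-1 -> x \in N^# -> x ^: H = N^#.
Proof.
move=> cardH Nx; have [_ _ _ nNH _] := sdprod_context defG.
apply/eqP; rewrite eqEcard class_sub_norm ?Nx /=; last by rewrite normD1.
rewrite -index_cent1 (semiregular_sym regNH) // indexg1 cardH.
by rewrite (cardsD1 1 N) group1.
Qed.

Lemma remgr_in g : g \in G -> remgr N H g \in H.
Proof. by move=> Gg; rewrite mem_remgr // (sdprodW defG). Qed.

Lemma divgr_in g : g \in G -> divgr N H g \in N.
Proof. by move=> Gg; rewrite mem_divgr // (sdprodW defG). Qed.

Lemma remgr_eq1 g : g \in G -> (remgr N H g == 1) = (g \in N).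
Proof.
move=> Gg; apply/eqP/idP=> [r1 | Ng]; last exact: remgr1.
by rewrite (divgr_eq N H g) r1 mulg1 divgr_in.
Qed.

(** Elements of [N] project to [1], which is not in [E]; so inside [N] only [eps] matters, and
    outside [N] only [E]. *)
Lemma mem_S_set eps (E : {set gT}) g :
    E \subset H^# -> g \in G ->
  (g \in S_set G N H eps E)
    = if g \in N then eps && (g != 1) else remgr N H g \in E.
Proof.
move=> sEH Gg; rewrite !inE Gg /=.
have defeps: (g \in scaled_kernel eps N) = [&& eps, g != 1 & g \in N].
  by case: eps; rewrite !inE.
rewrite defeps; case: ifP => Ng; rewrite ?andbF ?andbT //.
rewrite (remgr1 _ Ng); case E1: (1 \in E); last by rewrite orbF.
by have := subsetP sEH 1 E1; rewrite !inE eqxx.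
Qed.

(** The projection fixes [H] pointwise and [N] meets [H] only in [1]. This recovers [E] from the
    set, hence gives its uniqueness. *)
Lemma S_set_complement eps (E : {set gT}) :
  E \subset H^# -> S_set G N H eps E :&: H = E.
Proof.
move=> sEH; have [_ sHG _ _ tiNH] := sdprod_context defG.
apply/setP=> h; rewrite inE andbC; case Hh: (h \in H) => /=; last first.
  by apply/esym/negP=> /(subsetP sEH); rewrite !inE Hh andbF.
rewrite mem_S_set ?(subsetP sHG) // (remgr_id tiNH Hh).
case: ifP => // Nh; have: h \in N :&: H by rewrite inE Nh.
rewrite tiNH => /set1P->; rewrite eqxx andbF.
by apply/esym/negP=> /(subsetP sEH); rewrite !inE eqxx.
Qed.

Lemma admissible_setI (S : {set gT}) :
    S \subset G^# -> inverse_closed S -> union_of_classes G S ->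
  admissible H (S :&: H).
Proof.
move=> sSG1 invS /union_of_classesP[_ nSG].
have [_ sHG _ _ _] := sdprod_context defG.
split.
- apply/subsetP=> h /setIP[Sh Hh]; rewrite !inE Hh andbT.
  by have /setD1P[-> _] := subsetP sSG1 h Sh.
- by move=> h /setIP[Sh Hh]; rewrite inE groupV Hh invS.
apply/union_of_classesP; split; first exact: subsetIr.
by rewrite normsI ?normG // (subset_trans sHG).
Qed.

(** The element [x] is a test point: [N^#] is a single [H]-orbit, so whether [x] lies in [S] decides
    [eps]. *)
Lemma union_of_classes_S_set (S : {set gT}) x :
    #|H| = #|N|.-1 -> x \in N^# ->
    S \subset G^# -> union_of_classes G S ->
  S = S_set G N H (x \in S) (S :&: H).
Proof.
move=> cardH Nx sSG1 /union_of_classesP[_ nSG].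
have [nsNG sHG _ nNH tiNH] := sdprod_context defG.
have sNG := normal_sub nsNG.
have sEH: S :&: H \subset H^#.
  by rewrite subsetD1 subsetIr inE; apply/negP=> /andP[/(subsetP sSG1)];
     rewrite !inE eqxx.
have memJ y g: g \in G -> (y ^ g \in S) = (y \in S).
  by move=> Gg; rewrite memJ_norm // (subsetP nSG).
apply/setP=> g; case Gg: (g \in G); last first.
  apply/idP/idP=> [/(subsetP sSG1) | ]; first by rewrite !inE Gg andbF.
  case/setUP=> [| /setIdP[]]; last by rewrite Gg.
  by case: (x \in S); rewrite ?inE // => /andP[_ /(subsetP sNG)]; rewrite Gg.
rewrite mem_S_set //; case: ifP => [Ng | nNg].
  have [-> | ntg] := eqVneq g 1.
    by rewrite andbF; apply/negP=> /(subsetP sSG1); rewrite !inE eqxx.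
  have: g \in N^# by rewrite !inE ntg.
  rewrite -(kernel_class x cardH Nx) => /imsetP[h Hh ->].
  by rewrite andbT memJ // (subsetP sHG).
have Hr := remgr_in g Gg; rewrite inE Hr andbT.
have H1r: remgr N H g \in H^# by rewrite !inE Hr remgr_eq1 ?nNg.
(* Outside [N], [g] lies in the coset of its projection, which is the [N]-class of that projection;
   so [S] contains both or neither. *)
have: g \in remgr N H g ^: N.
  by rewrite coset_class // {1}(divgr_eq N H g) mem_rcoset mulgK divgr_in.
by case/imsetP=> n Nn {1}->; rewrite memJ // (subsetP sNG).
Qed.

(** Shows that the union in [S_set] is a disjoint one. *)
Lemma disjoint_kernel_preim eps (E : {set gT}) :
    E \subset H^# ->
  [disjoint scaled_kernel eps N & proj_preim G N H E].
Proof.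
move=> sEH; case: eps; last by rewrite /= disjoints_subset sub0set.
rewrite disjoints_subset; apply/subsetP=> x /setD1P[_ Nx]; rewrite !inE.
rewrite (remgr1 _ Nx) negb_and; apply/orP; right.
by apply/negP=> /(subsetP sEH); rewrite !inE eqxx.
Qed.

Lemma gen_S_set eps (E : {set gT}) :
    H :!=: 1 -> E \subset H^# ->
  <<S_set G N H eps E>> = G <-> <<E>> = H.
Proof.
move=> ntH sEH1; have [nsNG sHG defNH nNH tiNH] := sdprod_context defG.
have sNG := normal_sub nsNG.
have sEH: E \subset H by rewrite (subset_trans sEH1) ?subD1set.
have sSG: S_set G N H eps E \subset G.
  rewrite subUset; apply/andP; split; last by apply/subsetP=> g; case/setIdP.
  by case: eps; rewrite /= ?sub0set // subDset subsetU // sNG orbT.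
split=> [genS | genE].
  apply/eqP; rewrite eqEsubset gen_subG sEH /=.
  have nNE: <<E>> \subset 'N(N) by rewrite gen_subG (subset_trans sEH).
  (* As [<<E>>] normalises [N], this product is a group, so it is enough that it contains the
     generators. *)
  have sGNE: G \subset N * <<E>>.
    rewrite -{1}genS -(norm_joinEr nNE) gen_subG /= (norm_joinEr nNE).
    apply/subsetP=> g Sg; have Gg := subsetP sSG g Sg.
    move: Sg; rewrite mem_S_set //.
    case: ifP => [Ng _ | _ Er]; first by rewrite -[g]mulg1 mem_mulg ?group1.
    by rewrite (divgr_eq N H g) mem_mulg ?divgr_in ?mem_gen.
  apply/subsetP=> h Hh.
  (* If [h = n * e] with [h] and [e] in [H], then [n] lies in both [N] and [H], so it is [1]. *)
  have /mulsgP[n e Nn Ee defh] := subsetP sGNE h (subsetP sHG h Hh).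
  suff n1: n = 1 by rewrite defh n1 mul1g.
  have: n \in N :&: H.
    have He: e \in H by apply: subsetP Ee; rewrite gen_subG.
    by rewrite inE Nn -(groupMr n He) -defh.
  by rewrite tiNH => /set1P.
apply/eqP; rewrite eqEsubset gen_subG sSG /= -defNH.
have sES: E \subset S_set G N H eps E.
  by rewrite -{1}(S_set_complement eps E sEH1) subsetIl.
have sHS: H \subset <<S_set G N H eps E>> by rewrite -genE genS.
rewrite mul_subG //; apply/subsetP=> n Nn.
(* Since [H] is nontrivial, [E] has an element [e]. Both [e] and [n * e] are then in the generated
   group, hence so is [n], whatever [eps] is. *)
have [E0 | [e Ee]] := set_0Vmem E.
  by case/eqP: ntH; rewrite -genE E0 gen0.
have Hnt := subsetP sEH e Ee.
rewrite -(groupMr n (subsetP sHS e Hnt)) mem_gen // inE; apply/orP; right.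
by rewrite inE groupM ?(subsetP sNG n) ?(subsetP sHG e) // (remgrMid tiNH).
Qed.

End SemiregularSemidirect.

Theorem proposition3p3 (gT : finGroupType) (G N H : {group gT}) (q : nat)
    (frobG : frobenius_semidirect G N H)
    (q_ge3 : 3 <= q) (cardN : #|N| = q) (cardH : #|H| = q - 1) :
  (forall S : {set gT},
     S \subset G^# -> inverse_closed S -> union_of_classes G S ->
     exists! p : bool * {set gT},
       admissible H p.2 /\ S = S_set G N H p.1 p.2)
  /\
  (forall (eps : bool) (E : {set gT}), admissible H E ->
     [disjoint scaled_kernel eps N & proj_preim G N H E]
     /\ (<<S_set G N H eps E>> = G <-> <<E>> = H)).
Proof.
have [defG regNH] := frobG.
have ntH: H :!=: 1.
  by rewrite trivg_card1 cardH; case: q q_ge3 {cardN cardH} => [|[|[]]].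
have ntN: N :!=: 1.
  by rewrite trivg_card1 cardN; case: q q_ge3 {cardN cardH} => [|[]].
have cardHN: #|H| = #|N|.-1 by rewrite cardH cardN subn1.
split=> [S sSG1 invS clS | eps E [sEH _ _]]; last first.
  by split; [apply: (disjoint_kernel_preim eps) | apply: (gen_S_set defG)].
have [x N1x]: exists x, x \in N^#.
  by have [x Nx ntx] := trivgPn _ ntN; exists x; rewrite !inE ntx.
exists (x \in S, S :&: H); split=> /=.
  split; first exact: (admissible_setI defG).
  exact: (union_of_classes_S_set defG regNH).
case=> eps E /= [[sEH _ _] defS].
have /setD1P[ntx Nx] := N1x; have [nsNG _ _ _ _] := sdprod_context defG.
(* Uniqueness: intersecting with [H] returns [E], and testing [x] returns [eps]. *)
congr pair; last by rewrite defS (S_set_complement defG).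
by rewrite defS mem_S_set ?(subsetP (normal_sub nsNG)) // Nx ntx andbT.
Qed.
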